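(* Let $q$ be a power of $2$. The Gauss group is cyclic of order $2q$. If $I$ is an ideal of $\mathbb{Z}[i]$ whose norm is $\equiv5\pmod 8$, then the Gauss-class of $I$ generates the Gauss group.
   Context: Every ideal of $\mathbb{Z}[i]$ of odd norm has a generator $a+2bi$ with $a,b\in\mathbb{Z}$, $a$ odd, unique up to sign. Two such ideals $(\alpha)$, $(\beta)$ (generators of this form) are Gauss-equivalent if there is an integer $N$ with $N\alpha\equiv\beta\pmod{4q\mathbb{Z}[i]}$; the equivalence classes are called Gauss-classes. Products of an ideal in a class $R_1$ and an ideal in a class $R_2$ all lie in one Gauss-class, giving a multiplication on Gauss-classes; with it the Gauss-classes form a group, the Gauss group. *)

(* Defs.v *)
From HB Require Import structures.
From mathcomp Require Import all_boot all_order all_algebra all_fingroup.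
From mathcomp Require Import all_solvable.
From mathcomp Require Import finmap.
From mathcomp Require Import boolp classical_sets functions cardinality.
From mathcomp Require Import zify ring lra.

Set Implicit Arguments.
Unset Strict Implicit.
Unset Printing Implicit Defensive.

Import Order.TTheory GRing.Theory Num.Theory.
Local Open Scope classical_set_scope.
Local Open Scope ring_scope.

(** * The ring Z[i] *)

(* [GaussInt a b] is a + b i. *)
Record gaussInt := GaussInt { gRe : int; gIm : int }.

Definition gaussInt_pair (x : gaussInt) := (gRe x, gIm x).
Definition pair_gaussInt (p : int * int) := GaussInt p.1 p.2.
Lemma gaussInt_pairK : cancel gaussInt_pair pair_gaussInt.
Proof. by case. Qed.

HB.instance Definition _ := Choice.copy gaussInt (can_type gaussInt_pairK).

Definition gadd (x y : gaussInt) := GaussInt (gRe x + gRe y) (gIm x + gIm y).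
Definition gopp (x : gaussInt) := GaussInt (- gRe x) (- gIm x).
Definition gmul (x y : gaussInt) :=
  GaussInt (gRe x * gRe y - gIm x * gIm y) (gRe x * gIm y + gIm x * gRe y).

Fact gaddA : associative gadd.
Proof. by case=> a b [c d] [e f]; rewrite /gadd /= !addrA. Qed.
Fact gaddC : commutative gadd.
Proof. by case=> a b [c d]; rewrite /gadd /= (addrC a) (addrC b). Qed.
Fact gadd0 : left_id (GaussInt 0 0) gadd.
Proof. by case=> a b; rewrite /gadd /= !add0r. Qed.
Fact gaddN : left_inverse (GaussInt 0 0) gopp gadd.
Proof. by case=> a b; rewrite /gadd /= !addNr. Qed.

HB.instance Definition _ :=
  GRing.isZmodule.Build gaussInt gaddA gaddC gadd0 gaddN.

Fact gmulA : associative gmul.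
Proof. by case=> a b [c d] [e f]; congr GaussInt => /=; ring. Qed.
Fact gmulC : commutative gmul.
Proof. by case=> a b [c d]; congr GaussInt => /=; ring. Qed.
Fact gmul1 : left_id (GaussInt 1 0) gmul.
Proof. by case=> a b; congr GaussInt => /=; ring. Qed.
Fact gmulDl : left_distributive gmul gadd.
Proof. by case=> a b [c d] [e f]; congr GaussInt => /=; ring. Qed.
Fact gone_neq0 : GaussInt 1 0 != 0 :> gaussInt.
Proof. by []. Qed.

HB.instance Definition _ :=
  GRing.Zmodule_isComNzRing.Build gaussInt gmulA gmulC gmul1 gmulDl gone_neq0.

Definition gconj (x : gaussInt) := GaussInt (gRe x) (- gIm x).

(** * Ideals of Z[i] *)

Record ideal := Ideal {
  ideal_set :> gaussInt -> Prop;
  ideal0 : ideal_set 0;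
  idealD : forall x y, ideal_set x -> ideal_set y -> ideal_set (x + y);
  idealM : forall a x, ideal_set x -> ideal_set (a * x) }.

HB.instance Definition _ := gen_eqMixin ideal.
HB.instance Definition _ := gen_choiceMixin ideal.

Definition coset_ideal (I : ideal) (x : gaussInt) : set gaussInt :=
  [set y | I (y - x)].

(* The cardinality of Z[i]/I.  [fset_set] sends infinite sets to the empty one,
   so the zero ideal has norm 0. *)
Definition ideal_norm (I : ideal) : nat :=
  #|` fset_set [set coset_ideal I x | x in [set: gaussInt]] |.

Section PrincipalIdeal.
Variable al : gaussInt.
Let S := [set al * x | x in [set: gaussInt]].
Fact principal0 : S 0.
Proof. by exists 0; rewrite ?mulr0. Qed.
Fact principalD x y : S x -> S y -> S (x + y).
Proof. by move=> [u _ <-] [v _ <-]; exists (u + v); rewrite ?mulrDr. Qed.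
Fact principalM a x : S x -> S (a * x).
Proof. by move=> [u _ <-]; exists (a * u) => //; rewrite mulrCA. Qed.
Definition principal := Ideal principal0 principalD principalM.
End PrincipalIdeal.

Section ProductIdeal.
Variables I J : ideal.
Let S := [set z | exists2 s : seq (gaussInt * gaussInt),
  forall p, p \in s -> I p.1 /\ J p.2 & z = \sum_(p <- s) p.1 * p.2].
Fact mul_ideal0 : S 0.
Proof. by exists [::]; rewrite ?big_nil. Qed.
Fact mul_idealD x y : S x -> S y -> S (x + y).
Proof.
move=> [s hs ->] [t ht ->]; exists (s ++ t); last by rewrite big_cat.
by move=> p; rewrite mem_cat => /orP[/hs|/ht].
Qed.
Fact mul_idealM a x : S x -> S (a * x).
Proof.
move=> [s hs ->]; exists [seq (a * p.1, p.2) | p <- s].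
  by move=> p /mapP[p' /hs[p1 p2] ->]; split=> //; apply: idealM.
by rewrite big_map mulr_sumr; apply: eq_bigr => p _; rewrite mulrA.
Qed.
Definition mul_ideal := Ideal mul_ideal0 mul_idealD mul_idealM.
End ProductIdeal.

Definition odd_ideal := {I : ideal | odd (ideal_norm I)}.

(** * Gauss-equivalence *)

Definition normal_form (al : gaussInt) :=
  exists a b : int, odd `|a| /\ al = GaussInt a (2 * b).

Definition eqmod_gauss (m : nat) (x y : gaussInt) :=
  exists z : gaussInt, x - y = m%:R * z.

Definition gauss_equiv (q : nat) (I J : ideal) :=
  exists al be : gaussInt,
    [/\ normal_form al, normal_form be, I = principal al, J = principal be
      & exists N : int, eqmod_gauss (4 * q) (N%:~R * al) be].

(** * Arithmetic of Z[i] *)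

Lemma gaussP (x y : gaussInt) : gRe x = gRe y -> gIm x = gIm y -> x = y.
Proof. by case: x y => a b [c d] /= -> ->. Qed.

Lemma gReD x y : gRe (x + y) = gRe x + gRe y. Proof. by []. Qed.
Lemma gImD x y : gIm (x + y) = gIm x + gIm y. Proof. by []. Qed.
Lemma gReN x : gRe (- x) = - gRe x. Proof. by []. Qed.
Lemma gImN x : gIm (- x) = - gIm x. Proof. by []. Qed.
Lemma gReM x y : gRe (x * y) = gRe x * gRe y - gIm x * gIm y.
Proof. by []. Qed.
Lemma gImM x y : gIm (x * y) = gRe x * gIm y + gIm x * gRe y.
Proof. by []. Qed.
Lemma gnatE n : n%:R = GaussInt n%:Z 0.
Proof.
elim: n => [|n IH] //; rewrite -natr1 IH; apply: gaussP => //=.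
by lia.
Qed.
Lemma gintE (N : int) : N%:~R = GaussInt N 0.
Proof.
case: N => n; first by rewrite -[RHS]gnatE.
by rewrite NegzE mulrNz -pmulrn gnatE.
Qed.

Definition gE := (gReD, gImD, gReN, gImN, gReM, gImM, gnatE, gintE).

Definition gnorm (x : gaussInt) : int := gRe x ^+ 2 + gIm x ^+ 2.

Lemma gnormM x y : gnorm (x * y) = gnorm x * gnorm y.
Proof. by rewrite /gnorm !gE; ring. Qed.

Lemma gnorm_ge0 x : 0 <= gnorm x.
Proof. by rewrite /gnorm addr_ge0 ?sqr_ge0. Qed.

Lemma gnorm_eq0 x : (gnorm x == 0) = (x == 0).
Proof.
apply/idP/eqP => [|->] //; rewrite /gnorm paddr_eq0 ?sqr_ge0 // !sqrf_eq0.
by move=> /andP[/eqP h1 /eqP h2]; apply: gaussP.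
Qed.

Lemma gnorm_gt0 x : x != 0 -> 0 < gnorm x.
Proof. by move=> x0; rewrite lt_def gnorm_ge0 gnorm_eq0 x0. Qed.

Lemma gmulf_eq0 (x y : gaussInt) : (x * y == 0) = (x == 0) || (y == 0).
Proof. by rewrite -!gnorm_eq0 gnormM mulf_eq0. Qed.

Lemma gmulI (x y z : gaussInt) : x != 0 -> x * y = x * z -> y = z.
Proof.
move=> x0 e; apply/eqP; rewrite -subr_eq0.
have /eqP : x * (y - z) = 0 by rewrite mulrBr e subrr.
by rewrite gmulf_eq0 (negPf x0).
Qed.

Lemma round_div (u n : int) : 0 < n -> exists q : int, `|2 * (u - q * n)| <= n.
Proof.
move=> n0; exists ((2 * u + n) %/ (2 * n))%Z.
have n2 : 2 * n != 0 by lia.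
have := divz_eq (2 * u + n) (2 * n); have := modz_ge0 (2 * u + n) n2.
have : ((2 * u + n) %% (2 * n))%Z < 2 * n by apply: ltz_pmod; lia.
set r := (_ %% _)%Z; set d := (_ %/ _)%Z => h1 h2 h3.
have -> : 2 * (u - d * n) = r - n by rewrite mulrBr; move: h3; rewrite mulrCA; lia.
by rewrite ler_norml; lia.
Qed.

Lemma gauss_euclid (x y : gaussInt) : y != 0 ->
  exists q, gnorm (x - y * q) < gnorm y.
Proof.
move=> y0; have ny := gnorm_gt0 y0.
have [q1 h1] := round_div (gRe (x * gconj y)) ny.
have [q2 h2] := round_div (gIm (x * gconj y)) ny.
exists (GaussInt q1 q2).
set u := gRe _ - _ in h1; set v := gIm _ - _ in h2.
have e : gnorm (x - y * GaussInt q1 q2) * gnorm y = u ^+ 2 + v ^+ 2.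
  by rewrite /u /v /gnorm !gE /=; ring.
have sq w : `|2 * w| <= gnorm y -> 4 * w ^+ 2 <= gnorm y ^+ 2.
  move=> h; have -> : 4 * w ^+ 2 = `|2 * w| ^+ 2.
    by rewrite -normrX ger0_norm ?sqr_ge0 //; ring.
  by rewrite ler_sqr ?nnegrE ?gnorm_ge0.
have {}h1 := sq _ h1; have {}h2 := sq _ h2.
rewrite -(ltr_pM2r ny) e -expr2.
have : 0 < gnorm y ^+ 2 by rewrite exprn_gt0.
by move: (u ^+ 2) (v ^+ 2) (gnorm y ^+ 2) h1 h2 => *; lia.
Qed.

Lemma ideal_eq (I J : ideal) : ideal_set I = ideal_set J -> I = J.
Proof.
case: I J => I a b c [J a' b' c'] /= e; case: J / e a' b' c' => a' b' c'.
by congr Ideal; apply: Prop_irrelevance.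
Qed.

Lemma idealB (I : ideal) x y : I x -> I y -> I (x - y).
Proof. by move=> Ix Iy; apply: idealD => //; rewrite -mulN1r; apply: idealM. Qed.

Lemma ideal_principal (I : ideal) : exists al, I = principal al.
Proof.
have [[x [Ix x0]]|noI] := pselect (exists x, I x /\ x != 0); last first.
  exists 0; apply/ideal_eq/seteqP; split=> x /=.
    move=> Ix; exists 0; rewrite ?mul0r //; apply: contrapT => x0.
    by apply: noI; exists x; split=> //; apply/eqP => x0'; apply: x0.
  by move=> [y _ <-]; rewrite mul0r; apply: ideal0.
have exn : exists n : nat, `[< exists x, [/\ I x, x != 0 & gnorm x = n%:Z] >].
  by exists `|gnorm x|%N; apply/asboolP; exists x; rewrite gez0_abs ?gnorm_ge0.
case: (ex_minnP exn) => n /asboolP[al [Ial al0 nal]] minn.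
exists al; apply/ideal_eq/seteqP; split=> y /=; last first.
  by move=> [z _ <-]; rewrite mulrC; apply: idealM.
move=> Iy; have [q hq] := gauss_euclid y al0.
exists q => //; apply/eqP; rewrite eq_sym -subr_eq0; apply/negPn/negP => r0.
have := minn (absz (gnorm (y - al * q))); have := gnorm_ge0 (y - al * q).
suff H : `[< exists x, [/\ I x, x != 0 &
                        gnorm x = (absz (gnorm (y - al * q)))%:Z] >].
  by move=> ? /(_ H); lia.
apply/asboolP; exists (y - al * q); split=> //.
  by apply: idealB => //; rewrite mulrC; apply: idealM.
by rewrite gez0_abs ?gnorm_ge0.
Qed.

Lemma ideal_norm_card (I : ideal) (T : finType) (f : gaussInt -> T)
    (g : T -> gaussInt) :
  cancel g f -> (forall x y, f x = f y <-> I (x - y)) -> ideal_norm I = #|T|.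
Proof.
move=> gK fI; rewrite /ideal_norm.
have cosetE x y : f x = f y -> coset_ideal I x = coset_ideal I y.
  move=> /fI xy; apply/seteqP; split=> z; rewrite /coset_ideal /= => h.
    have -> : z - y = (z - x) + (x - y) by rewrite addrA subrK.
    exact: idealD.
  have -> : z - x = (z - y) - (x - y) by rewrite opprB addrA subrK.
  exact: idealB.
have -> : [set coset_ideal I x | x in [set: gaussInt]] =
          [set coset_ideal I (g t) | t in [set: T]].
  apply/seteqP; split=> _ [x _ <-]; last by exists (g x).
  by exists (f x) => //; apply: cosetE; rewrite gK.
rewrite fset_set_image; last exact: finite_finset.
rewrite card_imfset /=; last first.
  move=> s t e; rewrite -[s]gK -[t]gK; apply/fI.
  have : coset_ideal I (g s) (g s) by rewrite /coset_ideal /= subrr; apply: ideal0.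
  by rewrite e.
have -> : fset_set [set: T] = [fset x in T]%fset.
  apply/fsetP => x; rewrite in_fset_set; last exact: finite_finset.
  by rewrite !inE; apply/asboolP.
exact: card_finset.
Qed.

Definition resi n (x : int) : 'I_n.+1 := inord (absz (x %% n.+1)%Z).

Lemma resi_val n x : (resi n x : nat)%:Z = (x %% n.+1)%Z.
Proof.
have h := @ltz_pmod x n.+1 isT; have h' := @modz_ge0 x n.+1 isT.
by rewrite inordK; lia.
Qed.

Lemma resi_eq n x y : resi n x = resi n y <-> exists k, x - y = n.+1%:Z * k.
Proof.
split=> [e|[k e]].
  have := congr1 (fun z : 'I_n.+1 => (z : nat)%:Z) e; rewrite /= !resi_val => e'.
  exists ((x %/ n.+1)%Z - (y %/ n.+1)%Z).
  by rewrite {1}(divz_eq x n.+1) {1}(divz_eq y n.+1) e'; ring.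
apply/val_inj/eqP; rewrite /= -eqz_nat !resi_val.
have -> : x = k * n.+1 + y by rewrite mulrC -e subrK.
by rewrite modzMDl.
Qed.

Lemma resiK n (i : 'I_n.+1) : resi n (i : nat)%:Z = i.
Proof.
apply/val_inj/eqP; rewrite /= -eqz_nat resi_val modz_small //=.
by have := ltn_ord i; lia.
Qed.

Lemma ideal_norm_principal al : al != 0 ->
  ideal_norm (principal al) = absz (gnorm al).
Proof.
move=> al0.
have [u [v uv]] := Bezoutz (gRe al) (gIm al).
have /dvdzP[a' ea] := dvdz_gcdl (gRe al) (gIm al).
have /dvdzP[b' eb] := dvdz_gcdr (gRe al) (gIm al).
have g_ge0 : 0 <= gcdz (gRe al) (gIm al) by [].
move: (gcdz _ _) g_ge0 uv ea eb => g g_ge0 uv ea eb.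
have g0 : g != 0.
  by apply: contra_neq al0 => g0; apply: gaussP; rewrite ?ea ?eb g0 mulr0.
have {}uv : u * a' + v * b' = 1.
  by apply: (mulIf g0); rewrite mul1r -[RHS]uv ea eb; ring.
pose m := g * (a' ^+ 2 + b' ^+ 2).
have nE : gnorm al = g * m by rewrite /gnorm ea eb /m; ring.
have g_gt0 : 0 < g by rewrite lt_def g0.
have m_gt0 : 0 < m by rewrite -(pmulr_rgt0 _ g_gt0) -nE gnorm_gt0.
pose c := gRe al * v - gIm al * u.
have [G gE'] : exists G, g = G.+1%:Z by exists (absz g).-1; lia.
have [M mE] : exists M, m = M.+1%:Z by exists (absz m).-1; lia.
pose f z : 'I_G.+1 * 'I_M.+1 :=
  (resi G (gIm z), resi M (gRe z - c * (gIm z %/ g)%Z)).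
pose h (p : 'I_G.+1 * 'I_M.+1) := GaussInt (p.2 : nat)%:Z (p.1 : nat)%:Z.
have hK : cancel h f.
  move=> [i j]; rewrite /f /h /= resiK.
  rewrite divz_small; last by rewrite gE' /=; have := ltn_ord i; lia.
  by rewrite mulr0 subr0 resiK.
have fP x y : f x = f y <-> principal al (x - y).
  have key z : principal al z <-> exists k l, gIm z = g * k /\ gRe z = c * k + m * l.
    split=> [[[s t] _ <-]|[k [l [e1 e2]]]].
      exists (a' * t + b' * s), (s * u - t * v); rewrite !gE /= /c /m ea eb.
      split; first by ring.
      rewrite -[LHS]mulr1 -uv; ring.
    exists (GaussInt (k * v + l * a') (k * u - l * b')) => //.
    apply: gaussP; rewrite !gE /= ?e1 ?e2 /c /m ea eb; first by ring.
    by rewrite -[g * k]mulr1 -uv; ring.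
  have dg (z : int) : z = (z %/ g)%Z * g + (z %% g)%Z := divz_eq z g.
  split.
    case=> e1 /resi_eq[l e2].
    have e1' : (gIm x %% g)%Z = (gIm y %% g)%Z by rewrite gE' -!resi_val e1.
    apply/key; exists ((gIm x %/ g)%Z - (gIm y %/ g)%Z), l.
    rewrite !gE {1}(dg (gIm x)) {1}(dg (gIm y)) e1'; split; first by ring.
    rewrite mE -e2; ring.
  move=> /key[k [l]]; rewrite !gE => -[e1 e2].
  have e3 : gIm x = k * g + gIm y by rewrite mulrC -e1 subrK.
  congr pair; first by apply/resi_eq; exists k; rewrite -gE'.
  apply/resi_eq; exists l; rewrite -mE e3 divzMDl //.
  by have -> : gRe x = c * k + m * l + gRe y by [rewrite -e2 subrK]; ring.
by rewrite (ideal_norm_card hK fP) card_prod !card_ord nE gE' mE; lia.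
Qed.

Lemma ideal_norm_zero : ideal_norm (principal 0) = 0%N.
Proof.
rewrite /ideal_norm /fset_set; case: pselect => [fin|]; last by rewrite cardfs0.
exfalso; apply: infinite_nat.
pose f (n : nat) := coset_ideal (principal 0) n%:R.
have finj : injective f.
  move=> m n e; have : f m m%:R by exists 0; rewrite ?mul0r ?subrr.
  rewrite e => -[z _]; rewrite mul0r => /esym/eqP; rewrite subr_eq0 !gnatE.
  by move=> /eqP[].
apply: (@sub_finite_set _ [set: nat] (f @^-1` range (coset_ideal (principal 0)))).
  by move=> n _ /=; exists n%:R.
by apply: finite_preimage => // m n _ _; apply: finj.
Qed.

Lemma ideal_norm_gnorm al : ideal_norm (principal al) = absz (gnorm al).
Proof.
have [->|/ideal_norm_principal//] := eqVneq al 0; exact: ideal_norm_zero.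
Qed.

Lemma normal_formP al :
  normal_form al <-> odd (absz (gRe al)) /\ ~~ odd (absz (gIm al)).
Proof.
split=> [[a [b [oa ->]]]|[oa eb]] /=; first by split => //; lia.
exists (gRe al), (gIm al %/ 2)%Z; split=> //; apply: gaussP => //=; lia.
Qed.

Lemma absz_sqr_odd (x : int) : odd (absz (x ^+ 2)) = odd (absz x).
Proof. by rewrite abszX oddX. Qed.

Lemma gnorm_odd al :
  odd (absz (gnorm al)) = odd (absz (gRe al)) (+) odd (absz (gIm al)).
Proof.
rewrite -(absz_sqr_odd (gRe al)) -(absz_sqr_odd (gIm al)) /gnorm.
have := sqr_ge0 (gRe al); have := sqr_ge0 (gIm al).
move: (_ ^+ 2) (_ ^+ 2) => x y ? ?.
by rewrite -oddD; congr odd; lia.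
Qed.

Lemma normal_form_odd al : normal_form al -> odd (ideal_norm (principal al)).
Proof. by move=> /normal_formP[h1 h2]; rewrite ideal_norm_gnorm gnorm_odd h1. Qed.

Lemma principal_unit (u v al : gaussInt) : u * v = 1 ->
  principal (u * al) = principal al.
Proof.
move=> uv; apply/ideal_eq/seteqP; split=> x [z _ <-].
  by exists (u * z) => //; rewrite mulrCA mulrA.
by exists (v * z) => //; rewrite mulrACA uv mul1r.
Qed.

Lemma odd_ideal_generator (I : ideal) : odd (ideal_norm I) ->
  exists2 al, normal_form al & I = principal al.
Proof.
have [al ->] := ideal_principal I; rewrite ideal_norm_gnorm gnorm_odd => h.
have [oa|ea] := boolP (odd (absz (gRe al))).
  by exists al => //; apply/normal_formP; rewrite oa in h.
exists (GaussInt 0 1 * al); last first.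
  by rewrite (@principal_unit _ (GaussInt 0 (-1))).
apply/normal_formP; rewrite !gE /= !mul0r !mul1r sub0r add0r abszN.
by move: h; rewrite (negPf ea).
Qed.

Lemma gnorm1_normal (u : gaussInt) : gnorm u = 1 ->
  odd (absz (gRe u)) -> u = 1 \/ u = -1.
Proof.
case: u => a b; rewrite /gnorm /= => n1 oa.
have a2 : 1 <= a ^+ 2 by have : a != 0 by [lia]; nia.
have b0 : b = 0 by nia.
have : a = 1 \/ a = -1 by nia.
by case=> ->; [left|right]; rewrite b0.
Qed.

Lemma normal_form_uniq al be : normal_form al -> normal_form be ->
  principal al = principal be -> be = al \/ be = - al.
Proof.
move=> na nb e.
have al0 : al != 0.
  by apply/eqP => al0; have [] := (normal_formP al).1 na; rewrite al0.
have [u _ eu] : principal al be by rewrite e; exists 1; rewrite ?mulr1.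
have [v _ ev] : principal be al by rewrite -e; exists 1; rewrite ?mulr1.
have uv : u * v = 1 by apply: (gmulI al0); rewrite mulrA eu ev mulr1.
have nu : gnorm u = 1.
  have h : gnorm u * gnorm v = 1 by rewrite -gnormM uv.
  have /eqP := congr1 absz h; rewrite abszM muln_eq1 => /andP[/eqP n1 _].
  by have := gnorm_ge0 u; lia.
have ou : odd (absz (gRe u)).
  have [a [b [oa ea]]] := na; have [a2 [b2 [oa2 eb]]] := nb.
  move: eu; rewrite ea eb => /(congr1 gRe); rewrite !gE /=.
  move=> h; apply: contraTT oa2 => ou; rewrite -h.
  have [w ->] : exists w, gRe u = 2 * w by exists (gRe u %/ 2)%Z; lia.
  have -> : a * (2 * w) - 2 * b * gIm u = 2 * (a * w - b * gIm u) by ring.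
  by rewrite abszM oddM.
case: (gnorm1_normal nu ou) => uE; rewrite -eu uE; [left|right].
  by rewrite mulr1.
by rewrite mulrN1.
Qed.

Lemma normal_formM al be : normal_form al -> normal_form be ->
  normal_form (al * be).
Proof.
move=> [a [b [oa ->]]] [c [d [oc ->]]].
exists (a * c - 4 * b * d), (a * d + b * c); split; last first.
  by apply: gaussP; rewrite !gE /=; ring.
have : odd (absz (a * c)) by rewrite abszM oddM oa oc.
by rewrite -mulrA; move: (a * c) (b * d) => x y; lia.
Qed.

Lemma normal_form1 : normal_form 1.
Proof. by exists 1, 0; split=> //; apply: gaussP. Qed.

Lemma normal_form_conj al : normal_form al -> normal_form (gconj al).
Proof.
move=> [a [b [oa ->]]]; exists a, (- b); split => //.
by apply: gaussP => //=; ring.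
Qed.

Lemma mul_principal al be :
  mul_ideal (principal al) (principal be) = principal (al * be).
Proof.
apply/ideal_eq/seteqP; split=> x.
  move=> [s hs ->]; rewrite big_seq.
  apply: (big_ind (principal (al * be))).
  - exact: ideal0.
  - exact: idealD.
  by move=> [y z] /hs[[u _ /= <-] [v _ <-]]; exists (u * v) => //; rewrite mulrACA.
move=> [z _ <-]; exists [:: (al * z, be)].
  move=> p; rewrite inE => /eqP-> /=; split; first by exists z.
  by exists 1; rewrite ?mulr1.
by rewrite big_seq1 /= mulrAC.
Qed.

Lemma mul_ideal_odd (I J : ideal) : odd (ideal_norm I) -> odd (ideal_norm J) ->
  odd (ideal_norm (mul_ideal I J)).
Proof.
move=> /odd_ideal_generator[al na ->] /odd_ideal_generator[be nb ->].
by rewrite mul_principal; apply/normal_form_odd/normal_formM.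
Qed.

Definition mul_odd_ideal (I J : odd_ideal) : odd_ideal :=
  exist _ (mul_ideal (val I) (val J)) (mul_ideal_odd (valP I) (valP J)).

Definition odd_principal al (nal : normal_form al) : odd_ideal :=
  exist _ (principal al) (normal_form_odd nal).

Lemma odd_idealP (I : odd_ideal) :
  exists al (nal : normal_form al), I = odd_principal nal.
Proof.
have [al nal e] := odd_ideal_generator (valP I).
by exists al, nal; apply: val_inj.
Qed.

Lemma mul_odd_principal al be (na : normal_form al) (nb : normal_form be) :
  mul_odd_ideal (odd_principal na) (odd_principal nb) =
  odd_principal (normal_formM na nb).
Proof. by apply: val_inj; rewrite /= mul_principal. Qed.

Definition one_odd_ideal : odd_ideal := odd_principal normal_form1.

(** * The Gauss group *)

Lemma eqmodg_refl m x : eqmod_gauss m x x.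
Proof. by exists 0; rewrite subrr mulr0. Qed.

Lemma eqmodg_sym m x y : eqmod_gauss m x y -> eqmod_gauss m y x.
Proof. by move=> [z e]; exists (- z); rewrite mulrN -e opprB. Qed.

Lemma eqmodg_trans m y x z :
  eqmod_gauss m x y -> eqmod_gauss m y z -> eqmod_gauss m x z.
Proof.
by move=> [u e] [v e']; exists (u + v); rewrite mulrDr -e -e' addrA subrK.
Qed.

Lemma eqmodg_mul m x y x' y' : eqmod_gauss m x y -> eqmod_gauss m x' y' ->
  eqmod_gauss m (x * x') (y * y').
Proof.
move=> [u e] [v e']; exists (u * x' + y * v).
have -> : x * x' - y * y' = (x - y) * x' + y * (x' - y') by ring.
by rewrite e e'; ring.
Qed.

Lemma gauss_equivP q al be : normal_form al -> normal_form be ->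
  gauss_equiv q (principal al) (principal be) <->
  exists N : int, eqmod_gauss (4 * q) (N%:~R * al) be.
Proof.
move=> na nb; split=> [|h]; last by exists al, be.
have sgn (x y : gaussInt) : y = x \/ y = - x ->
    exists s : int, [/\ y = s%:~R * x & x = s%:~R * y].
  by case=> ->; [exists 1|exists (-1)]; split; ring.
move=> [al' [be' [na' nb' ea eb [N hN]]]].
have [s [_ es]] := sgn _ _ (normal_form_uniq na na' ea).
have [t [et _]] := sgn _ _ (normal_form_uniq nb' nb (esym eb)).
have [s' [es' _]] := sgn _ _ (normal_form_uniq na na' ea).
exists (t * N * s'); rewrite et !intrM -!mulrA -es'.
by apply: eqmodg_mul hN; apply: eqmodg_refl.
Qed.

Definition gauss_rel (k : nat) : rel odd_ideal :=
  fun I J => `[< gauss_equiv (2 ^ k) (val I) (val J) >].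

Lemma gauss_rel_refl k : reflexive (gauss_rel k).
Proof.
move=> I; have [al [na ->]] := odd_idealP I; apply/asboolP/gauss_equivP => //.
by exists 1; rewrite mul1r; apply: eqmodg_refl.
Qed.

Lemma gauss_rel_trans k : transitive (gauss_rel k).
Proof.
move=> J I K; have [al [na ->]] := odd_idealP I; have [be [nb ->]] := odd_idealP J.
have [ga [nc ->]] := odd_idealP K.
move=> /asboolP/(gauss_equivP _ na nb)[N hN] /asboolP/(gauss_equivP _ nb nc)[M hM].
apply/asboolP/gauss_equivP => //; exists (M * N).
apply: eqmodg_trans hM; rewrite intrM -mulrA.
by apply: eqmodg_mul hN; apply: eqmodg_refl.
Qed.

Lemma gauss_rel_sym k : symmetric (gauss_rel k).
Proof.
suff H I J : gauss_rel k I J -> gauss_rel k J I by move=> I J; apply/idP/idP => /H.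
have [al [na ->]] := odd_idealP I; have [be [nb ->]] := odd_idealP J.
move=> /asboolP/(gauss_equivP _ na nb)[N hN]; apply/asboolP/gauss_equivP => //.
have oN : odd (absz N).
  have [a [b [oa ea]]] := na; have [c [d [oc ec]]] := nb.
  case: hN => z; rewrite ea ec => /(congr1 gRe); rewrite !gE /= => h.
  apply: contraTT oc => eN.
  have [w wE] : exists w, N = 2 * w by exists (N %/ 2)%Z; lia.
  have -> : c = 2 * (w * a - 2 * (2 ^ k)%N%:Z * gRe z).
    by move: h; rewrite PoszM wE; lia.
  by rewrite abszM oddM.
have [[M L] /= hML] : exists p : int * int, p.1 * N + p.2 * (4 * 2 ^ k)%N%:Z = 1.
  have [M [L]] := Bezoutz N (4 * 2 ^ k)%N; rewrite /gcdz absz_nat.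
  have -> : gcdn (absz N) (4 * 2 ^ k) = 1%N.
    apply/eqP; rewrite -[_ == _]/(coprime _ _) coprimeMr.
    rewrite (@coprimeXr 2 _ 2) ?coprimen2 //=.
    by rewrite coprimeXr ?coprimen2.
  by exists (M, L).
exists M; apply: (@eqmodg_trans _ (M%:~R * (N%:~R * al))).
  by apply: eqmodg_mul; [apply: eqmodg_refl|apply: eqmodg_sym].
exists (- (L%:~R * al)).
rewrite mulrA -intrM; have -> : M * N = 1 - L * (4 * 2 ^ k)%N%:Z by rewrite -hML addrK.
by rewrite rmorphB rmorphM /= -pmulrn; ring.
Qed.

Canonical gauss_equiv_rel (k : nat) :=
  EquivRel (gauss_rel k) (@gauss_rel_refl k) (@gauss_rel_sym k)
    (@gauss_rel_trans k).

(* The group for q = 2 ^ k.  For a general q, [gauss_equiv q] need not be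
   symmetric. *)
Definition gaussGroup (k : nat) : Type := {eq_quot (gauss_equiv_rel k)}%qT.

HB.instance Definition _ k := EqQuotient.on (gaussGroup k).
HB.instance Definition _ k := Choice.on (gaussGroup k).

Definition gauss_class (k : nat) (I : odd_ideal) : gaussGroup k :=
  (\pi_(gaussGroup k) I)%qT.

Lemma gauss_classP k I J :
  gauss_class k I = gauss_class k J <-> gauss_equiv (2 ^ k) (val I) (val J).
Proof.
rewrite /gauss_class; split=> [/eqmodP/asboolP //|h].
by apply/eqmodP/asboolP.
Qed.

Definition gauss_repr k (x : gaussGroup k) : odd_ideal := generic_quotient.repr x.

Lemma gauss_class_repr k (x : gaussGroup k) : gauss_class k (gauss_repr x) = x.
Proof. exact: reprK. Qed.

Lemma gauss_class_surj k (x : gaussGroup k) :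
  exists al (na : normal_form al), x = gauss_class k (odd_principal na).
Proof.
have [al [na e]] := odd_idealP (gauss_repr x); exists al, na.
by rewrite -e gauss_class_repr.
Qed.

(* The class only depends on the residues of
   [gRe al] and [gIm al] modulo [4 * 2 ^ k]. *)
Section Finite.
Variable k : nat.
Let m := (4 * 2 ^ k).-1.
Let mE : m.+1 = (4 * 2 ^ k)%N. Proof. by rewrite prednK // muln_gt0 expn_gt0. Qed.

Let gen (x : gaussGroup k) : gaussInt :=
  projT1 (cid (gauss_class_surj x)).

Let code (x : gaussGroup k) : 'I_m.+1 * 'I_m.+1 :=
  (resi m (gRe (gen x)), resi m (gIm (gen x))).

Lemma code_inj : injective code.
Proof.
move=> x y; rewrite /code /gen.
case: cid => al /= [na ->]; case: cid => be /= [nb ->] [].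
move=> /resi_eq[u eu] /resi_eq[v ev]; apply/gauss_classP/gauss_equivP => //.
exists 1, (GaussInt u v); rewrite mul1r -mE; apply: gaussP; rewrite !gE /=.
  by rewrite eu; ring.
by rewrite ev; ring.
Qed.

Let decode p : option (gaussGroup k) :=
  if pselect (exists x, code x = p) is left e then Some (projT1 (cid e)) else None.

Lemma codeK : pcancel code decode.
Proof.
move=> x; rewrite /decode; case: pselect => [e|[]]; last by exists x.
by congr Some; case: cid => y /= /code_inj.
Qed.

HB.instance Definition _ : isCountable (gaussGroup k) := PCanIsCountable codeK.
HB.instance Definition _ : isFinite (gaussGroup k) := PCanIsFinite codeK.
End Finite.

Section Group.
Variable k : nat.

Definition gauss_mul (x y : gaussGroup k) : gaussGroup k :=
  gauss_class k (mul_odd_ideal (gauss_repr x) (gauss_repr y)).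

Definition gauss_one : gaussGroup k := gauss_class k one_odd_ideal.

Lemma gauss_classMP (I J : odd_ideal) :
  gauss_mul (gauss_class k I) (gauss_class k J) =
  gauss_class k (mul_odd_ideal I J).
Proof.
rewrite /gauss_mul; apply/gauss_classP.
have /gauss_classP : gauss_class k (gauss_repr (gauss_class k I)) = gauss_class k I.
  exact: gauss_class_repr.
have /gauss_classP : gauss_class k (gauss_repr (gauss_class k J)) = gauss_class k J.
  exact: gauss_class_repr.
move: (gauss_repr (gauss_class k J)) (gauss_repr (gauss_class k I)) => J' I'.
have [al [na ->]] := odd_idealP I; have [be [nb ->]] := odd_idealP J.
have [al' [na' ->]] := odd_idealP I'; have [be' [nb' ->]] := odd_idealP J'.
move=> /(gauss_equivP _ nb' nb)[N hN] /(gauss_equivP _ na' na)[M hM].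
rewrite !mul_odd_principal; apply/gauss_equivP; try exact: normal_formM.
exists (M * N); rewrite intrM mulrACA; exact: eqmodg_mul.
Qed.

Lemma conj_mul_class al (na : normal_form al) :
  gauss_mul (gauss_class k (odd_principal (normal_form_conj na)))
    (gauss_class k (odd_principal na)) = gauss_one.
Proof.
rewrite gauss_classMP mul_odd_principal.
apply/esym/gauss_classP/gauss_equivP; first exact: normal_form1.
  by apply: normal_formM => //; apply: normal_form_conj.
exists (gnorm al); rewrite mulr1.
have -> : gconj al * al = (gnorm al)%:~R.
  by apply: gaussP; rewrite /gnorm !gE /=; ring.
exact: eqmodg_refl.
Qed.

Lemma gauss_inv_ex (x : gaussGroup k) : exists y, gauss_mul y x = gauss_one.
Proof.
have [al [na ->]] := gauss_class_surj x.
by exists (gauss_class k (odd_principal (normal_form_conj na))); apply: conj_mul_class.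
Qed.

Definition gauss_inv (x : gaussGroup k) := projT1 (cid (gauss_inv_ex x)).

Fact gauss_mulA : associative gauss_mul.
Proof.
move=> x y z; rewrite -[x]gauss_class_repr -[y]gauss_class_repr.
rewrite -[z]gauss_class_repr !gauss_classMP; congr gauss_class.
have [al [na ->]] := odd_idealP (gauss_repr x); have [be [nb ->]] := odd_idealP (gauss_repr y).
have [ga [nc ->]] := odd_idealP (gauss_repr z); rewrite !mul_odd_principal.
by apply: val_inj; rewrite /= mulrA.
Qed.

Fact gauss_mul1 : left_id gauss_one gauss_mul.
Proof.
move=> x; rewrite -[x]gauss_class_repr gauss_classMP; congr gauss_class.
have [al [na ->]] := odd_idealP (gauss_repr x); rewrite mul_odd_principal.
by apply: val_inj; rewrite /= mul1r.
Qed.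

Fact gauss_mulV : left_inverse gauss_one gauss_inv gauss_mul.
Proof. by move=> x; rewrite /gauss_inv; case: cid. Qed.

HB.instance Definition _ :=
  Finite_isGroup.Build (gaussGroup k) gauss_mulA gauss_mul1 gauss_mulV.
End Group.

Lemma gauss_classM k (I J : odd_ideal) :
  gauss_class k (mul_odd_ideal I J) = (gauss_class k I * gauss_class k J)%g.
Proof. by rewrite -gauss_classMP. Qed.

Lemma odd_mod8 (n : nat) : n = 5 %[mod 8] -> odd n.
Proof. by lia. Qed.

(* Main.v *)
(* A class is represented by [1 + 2ti] with [t] modulo [2q], since the odd real
   part of a generator is invertible modulo [4q]; this bounds the order of the
   group by [2q].  If the norm of [a + 2bi] is 5 modulo 8, then [b] is odd, and
   repeated squaring shows that the imaginary part of [(a + 2bi)^(2^j)] is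
   exactly divisible by [2^(j+1)].  As a class is trivial iff [4q] divides the
   imaginary part of a generator, such an ideal has order exactly [2q]. *)
Require Import Defs.
From mathcomp Require Import all_boot all_fingroup all_solvable.
From mathcomp Require Import all_order all_algebra zify ring.

Import GRing.Theory.

Local Open Scope ring_scope.

(** Integer multiples of 1 are real, so a generator congruent to one has imaginary part 0 modulo
    $4q$; conversely the real part of [al] serves as the multiplier. *)
Lemma gauss_class_eq1 k al (na : normal_form al) :
  gauss_class k (odd_principal na) = 1%g <-> ((4 * 2 ^ k)%N %| gIm al)%Z.
Proof.
split.
  move=> /esym/gauss_classP/(gauss_equivP _ normal_form1 na)[N [z]].
  rewrite mulr1 => /(congr1 gIm); rewrite !gE /= => h.
  by apply/dvdzP; exists (- gIm z); lia.
move=> /dvdzP[z hz]; apply/esym/gauss_classP/gauss_equivP => //.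
  exact: normal_form1.
exists (gRe al), (GaussInt 0 (- z)); rewrite mulr1.
by apply: gaussP; rewrite !gE /= ?hz; ring.
Qed.

Lemma normal_form_slope (t : int) : normal_form (GaussInt 1 (2 * t)).
Proof. by exists 1, t. Qed.

(** Multiplying $a+2bi$ by an inverse $u$ of $a$ modulo $4q$ gives $1+2ubi$, where only $ub$ modulo
    $2q$ matters. *)
Lemma gauss_class_slope k (x : gaussGroup k) :
  exists t : 'I_(2 * 2 ^ k),
    x = gauss_class k (odd_principal (normal_form_slope (t : nat)%:Z)).
Proof.
have [al [na ->]] := gauss_class_surj x.
have [a [b [oa ea]]] := na.
have [u [v huv]] : exists u v : int, u * a + v * (4 * 2 ^ k)%N%:Z = 1.
  have [u [v]] := Bezoutz a (4 * 2 ^ k)%N; rewrite /gcdz absz_nat.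
  have -> : gcdn `|a| (4 * 2 ^ k) = 1%N.
    apply/eqP; rewrite -[_ == _]/(coprime _ _) coprimeMr.
    by rewrite (@coprimeXr 2 _ 2) ?coprimen2 //= coprimeXr ?coprimen2.
  by exists u, v.
have q0 : (0 < 2 ^ k)%N by rewrite expn_gt0.
have mE : (2 * 2 ^ k).-1.+1 = (2 * 2 ^ k)%N by rewrite prednK // muln_gt0.
pose t := resi (2 * 2 ^ k).-1 (u * b).
have tE := resi_val (2 * 2 ^ k).-1 (u * b).
exists (cast_ord mE t); apply/gauss_classP/gauss_equivP => //.
  exact: normal_form_slope.
(* Real part: $ua-1=-4qv$. Imaginary part: $2(ub-t)$ is $4q$ times the quotient of $ub$ by $2q$. *)
exists u, (GaussInt (- v) (u * b %/ (2 * 2 ^ k).-1.+1)%Z).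
have dE := divz_eq (u * b) (2 * 2 ^ k).-1.+1.
rewrite -tE {2}mE in dE.
rewrite ea; apply: gaussP; rewrite !gE /=.
  by rewrite mul0r !subr0 -huv; ring.
rewrite !mul0r !addr0 mulrCA {1}dE /t; move: (divz _ _) => d.
rewrite !PoszM; ring.
Qed.

Lemma card_gaussGroup_le k : (#|[set: gaussGroup k]| <= 2 * 2 ^ k)%N.
Proof.
pose f (t : 'I_(2 * 2 ^ k)) :=
  gauss_class k (odd_principal (normal_form_slope (t : nat)%:Z)).
rewrite -[X in (_ <= X)%N]card_ord; apply: leq_trans (leq_image_card f _).
apply: subset_leq_card; apply/subsetP => x _.
by have [t ->] := gauss_class_slope k x; apply: image_f.
Qed.

(** Squaring $c+2^{j+1}di$ gives imaginary part $2^{j+2}cd$ with $cd$ odd, so each squaring adds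
    exactly one factor 2. *)
Lemma gauss_class_exp2 k {a b} (na : normal_form (GaussInt a (2 * b))) j :
  odd `|a| -> odd `|b| ->
  exists c d (nc : normal_form (GaussInt c ((2 ^ j.+1)%N%:Z * d))),
    [/\ odd `|c|, odd `|d| &
      (gauss_class k (odd_principal na) ^+ (2 ^ j))%g =
      gauss_class k (odd_principal nc)].
Proof.
move=> oa ob; elim: j => [|j [c [d [nc [oc od e]]]]]; first by exists a, b, na.
pose c' := c * c - ((2 ^ j.+1)%N%:Z * d) ^+ 2.
have sqE : GaussInt c ((2 ^ j.+1)%N%:Z * d) * GaussInt c ((2 ^ j.+1)%N%:Z * d) =
    GaussInt c' ((2 ^ j.+2)%N%:Z * (c * d)).
  apply: gaussP; rewrite !gE /= /c'; first by ring.
  by rewrite [(2 ^ j.+2)%N]expnS PoszM; ring.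
have nc' := normal_formM nc nc; rewrite sqE in nc'.
exists c', (c * d), nc'; split.
- by have [] := (normal_formP _).1 nc'.
- by rewrite abszM oddM oc od.
rewrite expnSr expgM e expgS expg1 -gauss_classM mul_odd_principal.
by congr gauss_class; apply: val_inj; rewrite /= sqE.
Qed.

Lemma order_gauss_class k al (na : normal_form al) :
  ideal_norm (principal al) = 5 %[mod 8] ->
  #[gauss_class k (odd_principal na)]%g = (2 * 2 ^ k)%N.
Proof.
rewrite ideal_norm_gnorm => n5; have [a [b [oa ea]]] := na; subst al.
(* As $w(w+1)$ is even, $a^2=4w(w+1)+1$ is 1 modulo 8; norm 5 then forces $4b^2$ to be 4 modulo
   8. *)
have ob : odd `|b|.
  have [w wE] : exists w, a = 2 * w + 1 by exists (a %/ 2)%Z; lia.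
  have [v vE] : exists v, w * (w + 1) = 2 * v.
    have [h|h] : w = 2 * (w %/ 2)%Z \/ w = 2 * (w %/ 2)%Z + 1 by lia.
      by exists ((w %/ 2)%Z * (w + 1)); rewrite {1}h; ring.
    by exists (w * ((w %/ 2)%Z + 1)); rewrite {2}h; ring.
  have nE : Defs.gnorm (GaussInt a (2 * b)) = 4 * (w * (w + 1)) + 1 + 4 * (b * b).
    by rewrite /Defs.gnorm wE /=; ring.
  have : odd `|b * b|.
    have b2 : 0 <= b * b by rewrite -expr2 Num.Theory.sqr_ge0.
    have n0 := gnorm_ge0 (GaussInt a (2 * b)).
    by move: (b * b) (Defs.gnorm _) b2 n0 nE n5; rewrite vE; lia.
  by rewrite abszM oddM andbb.
have q0 : (0 < 2 ^ k)%N by rewrite expn_gt0.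
have x1 : (gauss_class k (odd_principal na) ^+ (2 ^ k.+1) = 1)%g.
  have [c [d [nc [_ _ ->]]]] := gauss_class_exp2 k na k.+1 oa ob.
  apply/gauss_class_eq1; apply/dvdzP; exists d => /=.
  by rewrite !expnS mulnA mulrC.
(* Here the imaginary part is $2^{k+1}d$ with $d$ odd, one factor 2 short of $4q=2^{k+2}$. *)
have x2 : (gauss_class k (odd_principal na) ^+ (2 ^ k) != 1)%g.
  have [c [d [nc [_ od ->]]]] := gauss_class_exp2 k na k oa ob.
  apply/eqP => /gauss_class_eq1 /dvdzP[z] /=.
  rewrite expnS !PoszM => h.
  have : d = 2 * z.
    apply: (@mulfI _ (2 * (2 ^ k)%N%:Z)); first lia.
    by rewrite h; ring.
  by move: od => /[swap] ->; rewrite abszM oddM.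
(* The $2^k$-th power has order exactly 2, so the class has order $2^k\cdot 2$. *)
rewrite mulnC; apply: orderXpfactor => //.
by apply: nt_prime_order => //; rewrite -expgM -expnSr.
Qed.

Local Open Scope group_scope.

Theorem theorem3p2 (k : nat) :
  [/\ cyclic [set: gaussGroup k],
      #|[set: gaussGroup k]| = (2 * 2 ^ k)%N
    & forall (I : ideal) (normI : ideal_norm I = 5 %[mod 8]),
        generator [set: gaussGroup k]
          (gauss_class k (exist _ I (odd_mod8 normI)))].
Proof.
(* The ideal $(1+2i)$ shows that the bound $2q$ is attained, and its class witnesses cyclicity. *)
have n5 : ideal_norm (principal (GaussInt 1 2)) = 5 %[mod 8].
  by rewrite ideal_norm_gnorm.
have n12 : normal_form (GaussInt 1 2) := normal_form_slope 1.
have card : #|[set: gaussGroup k]| = (2 * 2 ^ k)%N.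
  apply/eqP; rewrite eqn_leq card_gaussGroup_le.
  rewrite -(order_gauss_class k _ n12 n5).
  by apply: subset_leq_card; apply: subsetT.
have gen (I : ideal) (normI : ideal_norm I = 5 %[mod 8]) :
    generator [set: gaussGroup k] (gauss_class k (exist _ I (odd_mod8 normI))).
  have [al [na eI]] := odd_idealP (exist _ I (odd_mod8 normI)).
  have eI' : I = principal al := congr1 val eI.
  rewrite eI /generator eq_sym eqEcard subsetT card -orderE.
  by rewrite order_gauss_class ?leqnn -?eI'.
split=> //; apply/cyclicP.
by exists (gauss_class k (exist _ (principal _) (odd_mod8 n5))); apply/eqP/gen.
Qed.
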